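(* Let $L>0$, let $F:\mathbb{R}^d\to\mathbb{R}^d$ be $L$-Lipschitz and monotone, let $A:\mathbb{R}^d\rightrightarrows\mathbb{R}^d$ be maximally monotone, and let $z^\star$ be any solution of the monotone inclusion problem, i.e. $0\in F(z^\star)+A(z^\star)$. Let $z_0\in\mathbb{R}^d$ and $\gamma\ge 2$, and let $\{z_t\}_{t\ge 0}$ be generated by $$z_{t+1}=J_{\alpha_t A}\bigl[z_t-\alpha_tF(z_t)+\beta_t(z_0-z_t)\bigr],\qquad \alpha_t=\frac{1}{L\sqrt{t+\gamma}},\quad \beta_t=\frac{\gamma}{t+\gamma},\qquad t\ge 0.$$ Then for all $T\ge 1$, $$r^{\mathrm{tan}}_{F,A}(z_T)=\inf_{c\in A(z_T)}\lVert F(z_T)+c\rVert\le \frac{25(\sqrt{12}+1)L\gamma\lVert z_0-z^\star\rVert}{\sqrt{T-1+\gamma}}=O\left(\frac{L\lVert z_0-z^\star\rVert}{\sqrt{T}}\right),$$ where in the $O(\cdot)$ the parameter $\gamma$ is a fixed constant.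
   Context: $\mathbb{R}^d$ carries the Euclidean inner product $\langle\cdot,\cdot\rangle$ and norm $\lVert\cdot\rVert$. $F$ is monotone if $\langle F(z)-F(w),z-w\rangle\ge 0$ for all $z,w$, and $L$-Lipschitz if $\lVert F(z)-F(w)\rVert\le L\lVert z-w\rVert$ for all $z,w$. A set-valued operator $A:\mathbb{R}^d\rightrightarrows\mathbb{R}^d$ is monotone if $\langle a-b,z-w\rangle\ge0$ whenever $a\in A(z)$, $b\in A(w)$; it is maximally monotone if it is monotone and its graph is not a strict subset of the graph of another monotone operator. For $\alpha>0$, the resolvent is $J_{\alpha A}:=(\mathrm{Id}+\alpha A)^{-1}$, which for maximally monotone $A$ is a single-valued map defined on all of $\mathbb{R}^d$; $z=J_{\alpha A}(w)$ iff $(w-z)/\alpha\in A(z)$. The tangent residual is $r^{\mathrm{tan}}_{F,A}(z):=\inf_{c\in A(z)}\lVert F(z)+c\rVert$. *)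

(* Defs.v *)
From HB Require Import structures.
From mathcomp Require Import all_boot all_order all_algebra.
From mathcomp Require Import boolp classical_sets reals constructive_ereal ereal.

Set Implicit Arguments.
Unset Strict Implicit.
Unset Printing Implicit Defensive.

Import Order.TTheory GRing.Theory Num.Theory.

Local Open Scope classical_set_scope.
Local Open Scope ring_scope.

(* The norm that MathComp-Analysis puts on 'rV[R]_d is the sup norm, so the
   Euclidean structure of R^d is introduced here. *)
Definition dot (R : realType) (d : nat) (u v : 'rV[R]_d) : R :=
  \sum_(i < d) u 0 i * v 0 i.

Definition enorm (R : realType) (d : nat) (u : 'rV[R]_d) : R :=
  Num.sqrt (dot u u).

Definition monotone_map (R : realType) (d : nat)
    (F : 'rV[R]_d -> 'rV[R]_d) : Prop :=
  forall z w, 0 <= dot (F z - F w) (z - w).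

Definition lipschitz_map (R : realType) (d : nat) (L : R)
    (F : 'rV[R]_d -> 'rV[R]_d) : Prop :=
  forall z w, enorm (F z - F w) <= L * enorm (z - w).

(* A set-valued operator on R^d; [A z] may be empty. *)
Definition operator (R : realType) (d : nat) := 'rV[R]_d -> set 'rV[R]_d.

Definition graph (R : realType) (d : nat) (A : operator R d) :
    set ('rV[R]_d * 'rV[R]_d) :=
  [set p | A p.1 p.2].

Definition monotone_op (R : realType) (d : nat) (A : operator R d) : Prop :=
  forall z w a b, A z a -> A w b -> 0 <= dot (a - b) (z - w).

Definition maximally_monotone (R : realType) (d : nat)
    (A : operator R d) : Prop :=
  monotone_op A /\
  forall B : operator R d, monotone_op B -> ~ (graph A `<` graph B).

Definition op_inv (R : realType) (d : nat) (A : operator R d) : operator R d :=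
  fun w => [set z | A z w].

(* [resolvent a A] is (Id + a A)^-1 as a set-valued operator, so that
   [resolvent a A w z] means z \in J_{aA}(w). It is everywhere defined and
   single-valued when A is maximally monotone and a > 0. *)
Definition resolvent (R : realType) (d : nat) (a : R) (A : operator R d) :
    operator R d :=
  op_inv (fun z => [set z + a *: c | c in A z]).

(* The infimum is taken in the extended reals, hence is +oo if [A z] is empty. *)
Definition tangent_residual (R : realType) (d : nat)
    (F : 'rV[R]_d -> 'rV[R]_d) (A : operator R d) (z : 'rV[R]_d) : \bar R :=
  ereal_inf [set (enorm (F z + c))%:E | c in A z].

Definition inclusion_solution (R : realType) (d : nat)
    (F : 'rV[R]_d -> 'rV[R]_d) (A : operator R d) (z : 'rV[R]_d) : Prop :=
  [set F z + a | a in A z] 0.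

Definition step_size (R : realType) (L gamma : R) (t : nat) : R :=
  (L * Num.sqrt (t%:R + gamma))^-1.

Definition anchor_weight (R : realType) (gamma : R) (t : nat) : R :=
  gamma / (t%:R + gamma).

Definition anchored_forward_backward (R : realType) (d : nat) (L gamma : R)
    (F : 'rV[R]_d -> 'rV[R]_d) (A : operator R d) (z : nat -> 'rV[R]_d) : Prop :=
  forall t : nat,
    let alpha := step_size L gamma t in
    let beta := anchor_weight gamma t in
    resolvent alpha A (z t - alpha *: F (z t) + beta *: (z 0%N - z t)) (z t.+1).

Definition residual_bound (R : realType) (L gamma D : R) (T : nat) : R :=
  25%:R * (Num.sqrt 12%:R + 1) * L * gamma * D
    / Num.sqrt (T%:R - 1 + gamma).

(* Main.v *)
(* With n = t + gamma and D = |z_0 - zstar|, one has (alpha_t L)^2 = 1/n.  Since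
   F is monotone, the cross term in |p u - a (F x - F y)|^2, u = x - y, has the
   good sign, so the anchored forward map has squared Lipschitz constant at most
   (1 - gamma/n)^2 + 1/n, which for gamma >= 2 is at most (1 - gamma/(2n))^2 once
   t >= 1; hence |z_t - zstar| <= 2 D by induction.  The same estimate applied to
   consecutive iterates gives the recursion
     |z_(t+2) - z_(t+1)| <= (n - 1/4)/(n + 1) |z_(t+1) - z_t|
                            + 3 gamma D / (2 n (n + 1)),
   whose source term is exactly the gain in replacing 6 gamma D / n by
   6 gamma D / (n + 1), so that |z_(t+1) - z_t| <= 6 gamma D / n.  The element of
   A z_(t+1) selected by the resolvent then has residual O(L gamma D / sqrt n). *)

Require Import Defs.
From HB Require Import structures.
From mathcomp Require Import all_boot all_order all_algebra.
From mathcomp Require Import boolp classical_sets reals constructive_ereal ereal.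
From mathcomp Require Import ring lra.

Set Implicit Arguments.
Unset Strict Implicit.
Unset Printing Implicit Defensive.

Import Order.TTheory GRing.Theory Num.Theory.

Local Open Scope classical_set_scope.
Local Open Scope ring_scope.

(** * Euclidean inner product and norm, up to Cauchy-Schwarz and the triangle inequality *)

Section Euclidean.
Context (R : realType) (d : nat).
Implicit Types u v w : 'rV[R]_d.

Lemma dotC u v : dot u v = dot v u.
Proof. by apply: eq_bigr => i _; rewrite mulrC. Qed.

Lemma dotDl u v w : dot (u + v) w = dot u w + dot v w.
Proof. by rewrite -big_split; apply: eq_bigr => i _; rewrite mxE mulrDl. Qed.

Lemma dotZl a u v : dot (a *: u) v = a * dot u v.
Proof. by rewrite mulr_sumr; apply: eq_bigr => i _; rewrite mxE mulrA. Qed.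

Lemma dotDr u v w : dot u (v + w) = dot u v + dot u w.
Proof. by rewrite dotC dotDl !(dotC _ u). Qed.

Lemma dotZr a u v : dot u (a *: v) = a * dot u v.
Proof. by rewrite dotC dotZl dotC. Qed.

Lemma dotNl u v : dot (- u) v = - dot u v.
Proof. by rewrite -scaleN1r dotZl mulN1r. Qed.

Lemma dotNr u v : dot u (- v) = - dot u v.
Proof. by rewrite dotC dotNl dotC. Qed.

Definition dotE := (dotDl, dotDr, dotNl, dotNr, dotZl, dotZr).

Lemma dot_ge0 u : 0 <= dot u u.
Proof. by apply: sumr_ge0 => i _; rewrite -expr2 sqr_ge0. Qed.

Lemma enorm_ge0 u : 0 <= enorm u.
Proof. exact: sqrtr_ge0. Qed.

Lemma sqr_enorm u : enorm u ^+ 2 = dot u u.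
Proof. by rewrite sqr_sqrtr // dot_ge0. Qed.

Lemma enorm_le u (q : R) : 0 <= q -> dot u u <= q ^+ 2 -> enorm u <= q.
Proof. by move=> q0 h; rewrite -(ler_pXn2r (n := 2)) ?nnegrE ?enorm_ge0 // sqr_enorm. Qed.

Lemma enormZ a u : enorm (a *: u) = `|a| * enorm u.
Proof. by rewrite /enorm dotZl dotZr mulrA -expr2 sqrtrM ?sqr_ge0 // sqrtr_sqr. Qed.

Lemma enormB u v : enorm (u - v) = enorm (v - u).
Proof. by rewrite -opprB /enorm dotNl dotNr opprK. Qed.

Lemma enorm_eq0 u : enorm u = 0 -> u = 0.
Proof.
move=> /(congr1 (fun x => x ^+ 2)); rewrite sqr_enorm expr0n => /eqP.
rewrite psumr_eq0 => [/allP h|i _]; last by rewrite -expr2 sqr_ge0.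
apply/rowP => i; rewrite mxE; apply/eqP.
by have := h i (mem_index_enum i); rewrite /= mulf_eq0 orbb.
Qed.

Lemma dot_le_enorm u v : dot u v <= enorm u * enorm v.
Proof.
have [/enorm_eq0 ->|u0] := eqVneq (enorm u) 0.
  by rewrite -(scale0r v) dotZl mul0r mulr_ge0 ?enorm_ge0.
have [/enorm_eq0 ->|v0] := eqVneq (enorm v) 0.
  by rewrite -(scale0r u) dotZr mul0r mulr_ge0 ?enorm_ge0.
have p : 0 < enorm u * enorm v by rewrite mulr_gt0 // lt_neqAle eq_sym ?u0 ?v0 enorm_ge0.
(* Expanded, this square is 2|u||v| (|u||v| - <u,v>), and the factor in front is positive. *)
have := dot_ge0 (enorm v *: u - enorm u *: v).
rewrite !dotE (dotC v u) -!sqr_enorm => h.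
rewrite -(ler_pM2l p); nra.
Qed.

Lemma enormD u v : enorm (u + v) <= enorm u + enorm v.
Proof.
apply: enorm_le; first by rewrite addr_ge0 ?enorm_ge0.
rewrite !dotE (dotC v u) sqrrD !sqr_enorm; have := dot_le_enorm u v; lra.
Qed.

End Euclidean.

(** * The backward and forward halves of one step *)

Lemma resolvent_nonexpansive (R : realType) (d : nat) (A : operator R d) (a : R)
    (x y c b : 'rV[R]_d) :
  monotone_op A -> 0 <= a -> A x c -> A y b ->
  enorm (x - y) <= enorm ((x + a *: c) - (y + a *: b)).
Proof.
move=> mA a0 Axc Ayb; apply: enorm_le; rewrite ?enorm_ge0 // sqr_enorm.
(* The squared norm is |x-y|^2 + 2a<c-b,x-y> + a^2|c-b|^2, whose cross term is nonnegative by
   monotonicity. *)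
have -> : x + a *: c - (y + a *: b) = (x - y) + a *: (c - b).
  by apply/rowP => i; rewrite !mxE; ring.
have h : 0 <= a * dot (c - b) (x - y) by rewrite mulr_ge0 //; apply: (mA x y).
rewrite (dotDl (x - y)) !(dotDr _ (x - y)) !dotZr !dotZl (dotC (x - y) (c - b)).
have := mulr_ge0 (sqr_ge0 a) (dot_ge0 (c - b)); lra.
Qed.

(** The weight [p] stays general to serve two comparisons: it is 1 - beta against a solution, and
    the step ratio times 1 - beta between consecutive iterates. *)
Lemma forward_step_le (R : realType) (d : nat) (F : 'rV[R]_d -> 'rV[R]_d)
    (L p a q : R) (u v : 'rV[R]_d) :
  monotone_map F -> lipschitz_map L F -> 0 <= p -> 0 <= a -> 0 <= q ->
  p ^+ 2 + (a * L) ^+ 2 <= q ^+ 2 ->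
  enorm (p *: (u - v) - a *: (F u - F v)) <= q * enorm (u - v).
Proof.
move=> mF lF p0 a0 q0 hq; apply: enorm_le; first by rewrite mulr_ge0 ?enorm_ge0.
have hm := mulr_ge0 (mulr_ge0 p0 a0) (mF u v).
have hl : dot (F u - F v) (F u - F v) <= L ^+ 2 * dot (u - v) (u - v).
  rewrite -!sqr_enorm -exprMn ler_pXn2r ?nnegrE ?enorm_ge0 //.
  exact: le_trans (enorm_ge0 _) (lF u v).
have := ler_wpM2l (sqr_ge0 a) hl.
have := ler_wpM2r (dot_ge0 (u - v)) hq.
rewrite (exprMn _ q) sqr_enorm (dotDl (p *: _)) !(dotDr _ (p *: _)) !dotNl !dotNr !dotZl !dotZr.
rewrite (dotC (u - v) (F u - F v)); lra.
Qed.

(** * Scalar estimates on step sizes and anchor weights *)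

Section StepSizes.
Context (R : realType) (L gamma : R).
Context (hgamma : 2%:R <= gamma) (L0 : 0 < L).

Lemma index_gt0 (t : nat) : 0 < t%:R + gamma.
Proof. by have := hgamma; have := ler0n R t; lra. Qed.

Lemma step_size_gt0 t : 0 < step_size L gamma t.
Proof. by rewrite invr_gt0 mulr_gt0 // sqrtr_gt0 index_gt0. Qed.

Lemma step_sizeM t : step_size L gamma t * L = (Num.sqrt (t%:R + gamma))^-1.
Proof. by rewrite /step_size invfM mulrAC mulVf ?mul1r // gt_eqF. Qed.

Lemma sqr_step_sizeM t : (step_size L gamma t * L) ^+ 2 = (t%:R + gamma)^-1.
Proof. by rewrite step_sizeM exprVn sqr_sqrtr // ltW ?index_gt0. Qed.

Lemma anchor_weight_ge0 t : 0 <= anchor_weight gamma t.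
Proof. by rewrite divr_ge0 // ?ltW ?index_gt0 //; have := hgamma; lra. Qed.

Lemma anchor_weight_le1 t : anchor_weight gamma t <= 1.
Proof. by rewrite ler_pdivrMr ?index_gt0 // mul1r lerDr. Qed.

Lemma anchored_factor_le t : (1 <= t)%N ->
  (1 - anchor_weight gamma t) ^+ 2 + (step_size L gamma t * L) ^+ 2
    <= (1 - anchor_weight gamma t / 2%:R) ^+ 2.
Proof.
have hg := hgamma; rewrite sqr_step_sizeM /anchor_weight => t1.
have {t1} : 1 <= t%:R :> R by rewrite ler1n.
have := index_gt0 t; set n := t%:R + gamma => n0 t1.
have hn : gamma + 1 <= n by rewrite /n; lra.
rewrite -subr_ge0.
(* At n = gamma + 1 the numerator is gamma^2/4 - 1, which is nonnegative because gamma >= 2; it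
   increases with n. *)
have -> : (1 - gamma / n / 2%:R) ^+ 2 - ((1 - gamma / n) ^+ 2 + n^-1)
   = ((gamma - 1) * n - 3 / 4 * gamma ^+ 2) / n ^+ 2 by field; rewrite gt_eqF.
by apply: divr_ge0; rewrite ?sqr_ge0 //; nra.
Qed.

(** The quotient alpha_(t+1) / alpha_t, from which L cancels. *)
Definition step_ratio t := Num.sqrt (t%:R + gamma) / Num.sqrt (t.+1%:R + gamma).

Lemma step_sizeS t : step_size L gamma t.+1 = step_ratio t * step_size L gamma t.
Proof.
rewrite /step_size /step_ratio; field.
by rewrite !gt_eqF // ?sqrtr_gt0 ?index_gt0.
Qed.

Lemma step_ratio_ge0 t : 0 <= step_ratio t.
Proof. by rewrite divr_ge0 ?sqrtr_ge0. Qed.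

Lemma drift_factor_le t (m := t%:R + gamma) :
  (step_ratio t * (1 - anchor_weight gamma t)) ^+ 2 + (step_size L gamma t.+1 * L) ^+ 2
    <= ((m - 4%:R^-1) / (m + 1)) ^+ 2.
Proof.
have hg := hgamma; rewrite sqr_step_sizeM /step_ratio exprMn expr_div_n !sqr_sqrtr ?(ltW (index_gt0 _)) //.
rewrite /anchor_weight -/m.
have -> : t.+1%:R + gamma = m + 1 by rewrite -natr1 /m; ring.
have hm : gamma <= m by rewrite lerDr.
have m0 : 0 < m by lra.
rewrite -subr_ge0.
have -> : ((m - 4%:R^-1) / (m + 1)) ^+ 2
    - (m / (m + 1) * (1 - gamma / m) ^+ 2 + (m + 1)^-1)
  = (m * (m - 4%:R^-1) ^+ 2 - ((m - gamma) ^+ 2 + m) * (m + 1)) / (m * (m + 1) ^+ 2).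
  by field; rewrite !gt_eqF //; lra.
apply: divr_ge0; last by rewrite mulr_ge0 ?sqr_ge0 // ltW.
(* With m = gamma + s and gamma = 2 + g, the numerator becomes a polynomial in g, s >= 0 whose
   coefficients are all nonnegative; its constant term is 1/8. *)
have [s s0 ->] : exists2 s, 0 <= s & m = gamma + s by exists (m - gamma); lra.
have [g g0 ->] : exists2 g, 0 <= g & gamma = 2%:R + g by exists (gamma - 2%:R); lra.
have := mulr_ge0 g0 s0; have := mulr_ge0 g0 g0; have := mulr_ge0 s0 s0.
have := mulr_ge0 g0 (mulr_ge0 g0 s0); have := mulr_ge0 g0 (mulr_ge0 s0 s0).
have := mulr_ge0 g0 (mulr_ge0 g0 g0).
lra.
Qed.

(** Both weights are of order 1/m, but their difference is of order 1/m^2: with r = sqrt m and s =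
    sqrt (m+1), it equals -gamma / (s^2 r (r+s)) since s^2 - r^2 = 1, and r + s >= 2r. *)
Lemma anchor_drift_le t (m := t%:R + gamma) :
  `|anchor_weight gamma t.+1 - step_ratio t * anchor_weight gamma t|
    <= gamma / (2%:R * (m * (m + 1))).
Proof.
rewrite /step_ratio /anchor_weight -/m.
have -> : t.+1%:R + gamma = m + 1 by rewrite -natr1 /m; ring.
have m0 : 0 < m by exact: index_gt0.
have m10 : 0 < m + 1 by lra.
have hr : Num.sqrt m ^+ 2 = m by rewrite sqr_sqrtr // ltW.
have hs : Num.sqrt (m + 1) ^+ 2 = m + 1 by rewrite sqr_sqrtr // ltW.
have := m0; rewrite -sqrtr_gt0; set r := Num.sqrt m in hr * => r0.
have := m10; rewrite -sqrtr_gt0; set s := Num.sqrt (m + 1) in hs * => s0.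
have rs : r <= s by rewrite ler_sqrt //; lra.
rewrite -hs -hr.
have -> : gamma / s ^+ 2 - r / s * (gamma / r ^+ 2)
     = - (gamma * (s ^+ 2 - r ^+ 2) / (s ^+ 2 * r * (r + s))).
  by field; rewrite !gt_eqF ?addr_gt0.
have -> : s ^+ 2 - r ^+ 2 = 1 by rewrite hs hr; ring.
have g0 : 0 <= gamma by have := hgamma; lra.
rewrite normrN mulr1 ger0_norm; last first.
  by rewrite divr_ge0 // !mulr_ge0 ?sqr_ge0 ?addr_ge0 // ltW.
rewrite ler_wpM2l // lef_pV2 ?posrE ?mulr_gt0 ?exprn_gt0 ?addr_gt0 //.
have -> : 2%:R * (r ^+ 2 * s ^+ 2) = s ^+ 2 * r * (r + r) by ring.
by rewrite ler_wpM2l ?lerD2l // mulr_ge0 ?sqr_ge0 // ltW.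
Qed.

End StepSizes.

(** * Boundedness of the iterates, decay of the drift, and the residual *)

Section Iterates.
Context (R : realType) (d : nat) (L gamma : R) (F : 'rV[R]_d -> 'rV[R]_d).
Context (A : operator R d) (zstar : 'rV[R]_d) (z : nat -> 'rV[R]_d).
Context (hgamma : 2%:R <= gamma) (L0 : 0 < L).
Context (lF : lipschitz_map L F) (mF : monotone_map F) (mA : monotone_op A).
Context (hstar : inclusion_solution F A zstar).
Context (hz : anchored_forward_backward L gamma F A z).

Local Notation alpha := (step_size L gamma).
Local Notation beta := (anchor_weight gamma).
Local Notation D := (enorm (z 0%N - zstar)).

Lemma anchored_step t : exists2 c, A (z t.+1) c &
  z t.+1 + alpha t *: c = z t - alpha t *: F (z t) + beta t *: (z 0%N - z t).
Proof. by case: (hz t) => c; exists c. Qed.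

(** Since -F zstar lies in A zstar, zstar is the resolvent of zstar - alpha F zstar.
    Nonexpansiveness then leaves a forward step plus the anchor's pull beta (z_0 - zstar). *)
Lemma anchored_step_dist t (q : R) : 0 <= q ->
  (1 - beta t) ^+ 2 + (alpha t * L) ^+ 2 <= q ^+ 2 ->
  enorm (z t.+1 - zstar) <= q * enorm (z t - zstar) + beta t * D.
Proof.
move=> q0 hq; have [c Ac hc] := anchored_step t.
have [a Aa ha] := hstar.
have a0 : 0 <= alpha t by rewrite ltW ?step_size_gt0.
apply: le_trans (resolvent_nonexpansive mA a0 Ac Aa) _; rewrite hc.
have -> : z t - alpha t *: F (z t) + beta t *: (z 0%N - z t) - (zstar + alpha t *: a)
  = ((1 - beta t) *: (z t - zstar) - alpha t *: (F (z t) - F zstar))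
    + beta t *: (z 0%N - zstar).
  have -> : a = - F zstar by apply/eqP; rewrite -addr_eq0 addrC ha.
  by apply/rowP => i; rewrite !mxE; ring.
apply: le_trans (enormD _ _) _; rewrite enormZ ger0_norm ?anchor_weight_ge0 //.
rewrite lerD2r; apply: (forward_step_le _ _ mF lF) => //.
by rewrite subr_ge0 anchor_weight_le1.
Qed.

(** The value 2D is the fixed point of x -> (1 - beta/2) x + beta D, so it propagates from t = 1
    on. *)
Lemma iterate_dist_le t : enorm (z t - zstar) <= 2%:R * D.
Proof.
have D0 : 0 <= D := enorm_ge0 _.
elim: t => [|[|t] IH]; first lra.
  (* The first step is separate, as [anchored_factor_le] starts at t = 1. Here beta = 1 and (alpha
     L)^2 = 1/gamma <= 1, so the factor 1 gives D + D. *)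
  have b1 : beta 0 = 1.
    by rewrite /anchor_weight add0r divff // gt_eqF //; have := hgamma; lra.
  apply: le_trans (@anchored_step_dist 0 1 _ _) _ => //; last by rewrite b1; lra.
  rewrite b1 subrr expr0n add0r sqr_step_sizeM // expr1n add0r.
  by rewrite invf_le1; have := hgamma; lra.
have b0 := anchor_weight_ge0 hgamma t.+1; have b1 := anchor_weight_le1 hgamma t.+1.
apply: le_trans (anchored_step_dist _ (anchored_factor_le hgamma L0 _)) _ => //.
  by lra.
have : 0 <= 1 - beta t.+1 / 2%:R by lra.
by move=> /ler_wpM2l /(_ _ _ IH); lra.
Qed.

Lemma anchor_dist_le t : enorm (z 0%N - z t) <= 3%:R * D.
Proof.
have -> : z 0%N - z t = (z 0%N - zstar) + (zstar - z t) by rewrite addrA subrK.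
have := enormD (z 0%N - zstar) (zstar - z t).
by have := iterate_dist_le t; rewrite (enormB zstar); lra.
Qed.

(* Rescaling the inclusion at step [t] by [step_ratio] exhibits [z t.+1], like
   [z t.+2], as a value of the resolvent with the later step size, so that
   nonexpansiveness applies although the step sizes vary. *)
Lemma iterate_drift_rec t (m := t%:R + gamma) :
  enorm (z t.+2 - z t.+1) <=
    (m - 4%:R^-1) / (m + 1) * enorm (z t.+1 - z t)
    + gamma / (2%:R * (m * (m + 1))) * (3%:R * D).
Proof.
have hg := hgamma; have hm : gamma <= m by rewrite lerDr.
have [c Ac hc] := anchored_step t; have [c' Ac' hc'] := anchored_step t.+1.
have a0 : 0 <= alpha t.+1 by rewrite ltW ?step_size_gt0.
apply: le_trans (resolvent_nonexpansive mA a0 Ac' Ac) _; rewrite hc'.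
set r := step_ratio gamma t.
have -> : z t.+1 - alpha t.+1 *: F (z t.+1) + beta t.+1 *: (z 0%N - z t.+1)
    - (z t.+1 + alpha t.+1 *: c)
  = ((r * (1 - beta t)) *: (z t.+1 - z t) - alpha t.+1 *: (F (z t.+1) - F (z t)))
    + (beta t.+1 - r * beta t) *: (z 0%N - z t.+1).
  have -> : alpha t.+1 *: c =
      r *: (z t - alpha t *: F (z t) + beta t *: (z 0%N - z t) - z t.+1).
    by rewrite -hc addrC addKr scalerA -step_sizeS.
  by rewrite step_sizeS // -/r; apply/rowP => i; rewrite !mxE; ring.
apply: le_trans (enormD _ _) _; rewrite enormZ lerD //.
  apply: (forward_step_le _ _ mF lF) => //.
  - by rewrite mulr_ge0 ?step_ratio_ge0 // subr_ge0 anchor_weight_le1.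
  - by rewrite divr_ge0 //; lra.
  - exact: drift_factor_le.
by rewrite ler_pM ?normr_ge0 ?enorm_ge0 ?anchor_drift_le ?anchor_dist_le.
Qed.

Lemma iterate_drift_le t :
  enorm (z t.+1 - z t) <= 6%:R * gamma * D / (t%:R + gamma).
Proof.
have hg := hgamma; have D0 : 0 <= D := enorm_ge0 _.
elim: t => [|t IH].
  (* At t = 0 the bound reads 6D, and 3D is already available. *)
  rewrite add0r mulrAC mulfK; last by rewrite gt_eqF //; lra.
  by have := anchor_dist_le 1; rewrite enormB; lra.
apply: le_trans (iterate_drift_rec t) _.
have := index_gt0 hgamma t; have : gamma <= t%:R + gamma by rewrite lerDr.
have -> : t.+1%:R + gamma = t%:R + gamma + 1 by rewrite -natr1; ring.
move: (t%:R + gamma) IH => m IH hm m0.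
have q0 : 0 <= (m - 4%:R^-1) / (m + 1) by rewrite divr_ge0 //; lra.
apply: le_trans (lerD (ler_wpM2l q0 IH) (lexx _)) _.
(* Equality holds: the source 3 gamma D / (2m(m+1)) is exactly what the -1/4 takes off 6 gamma D /
   m. *)
rewrite le_eqVlt; apply/orP; left; apply/eqP.
by field; rewrite !gt_eqF //; lra.
Qed.

(** Solving the step for c splits F z_(t+1) + c into a Lipschitz term, a drift term and an anchor
    term. They contribute 6, 6 and 3 to the constant 15. *)
Lemma tangent_residual_le t :
  (tangent_residual F A (z t.+1)
    <= (15%:R * L * gamma * D / Num.sqrt (t%:R + gamma))%:E)%E.
Proof.
have hg := hgamma; have hL := L0.
have [c Ac hc] := anchored_step t.
apply: le_trans (ereal_inf_lbound _) _; first by exists c.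
rewrite lee_fin.
have n0 := index_gt0 hgamma t; have hn : gamma <= t%:R + gamma by rewrite lerDr.
have hs : Num.sqrt (t%:R + gamma) ^+ 2 = t%:R + gamma by rewrite sqr_sqrtr // ltW.
have := n0; rewrite -sqrtr_gt0.
have ha : (alpha t)^-1 = L * Num.sqrt (t%:R + gamma) by rewrite invrK.
have hab : (alpha t)^-1 * beta t = L * gamma / Num.sqrt (t%:R + gamma).
  rewrite ha /anchor_weight -{2}hs; field.
  by rewrite gt_eqF // sqrtr_gt0.
have hd := iterate_drift_le t; rewrite -hs in hd.
move: hs ha hab hd; set s := Num.sqrt _ => hs ha hab hd s0.
have s1 : 1 <= s by nra.
have -> : F (z t.+1) + c = (F (z t.+1) - F (z t))
   + ((alpha t)^-1 *: (z t - z t.+1) + ((alpha t)^-1 * beta t) *: (z 0%N - z t)).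
  have -> : c = (alpha t)^-1 *: (z t - alpha t *: F (z t) + beta t *: (z 0%N - z t) - z t.+1).
    by rewrite -hc addrC addKr scalerA mulVf ?scale1r // gt_eqF // step_size_gt0.
  rewrite -scalerA -scalerDr.
  apply/rowP => i; rewrite !mxE; field.
  by rewrite gt_eqF // step_size_gt0.
have h1 := enormD (F (z t.+1) - F (z t))
   ((alpha t)^-1 *: (z t - z t.+1) + ((alpha t)^-1 * beta t) *: (z 0%N - z t)).
have h2 := enormD ((alpha t)^-1 *: (z t - z t.+1)) (((alpha t)^-1 * beta t) *: (z 0%N - z t)).
apply: le_trans h1 _; apply: le_trans (lerD (lF _ _) h2) _.
rewrite !enormZ hab ha (enormB (z t)).
have w0 : 0 <= L * gamma / s by rewrite !mulr_ge0 ?invr_ge0 //; lra.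
have Ls : 0 <= L * s by rewrite mulr_ge0; lra.
rewrite !ger0_norm //.
have e1 : enorm (z t.+1 - z t) * s <= 6%:R * gamma * D / s.
  rewrite -ler_pdivlMr //; apply: le_trans hd _.
  by rewrite expr2 invfM mulrA.
have e2 := ler_wpM2l (ltW L0) e1.
have e3 := ler_wpM2l w0 (anchor_dist_le t).
(* As s >= 1, the Lipschitz term is absorbed into the same bound as the drift term. *)
have e4 : L * enorm (z t.+1 - z t) <= L * (enorm (z t.+1 - z t) * s).
  by rewrite ler_pM2l // ler_peMr ?enorm_ge0.
lra.
Qed.

End Iterates.

(* The constant C of the O(.) depends on gamma only. *)
Theorem theorem1 (R : realType) (gamma : R) (hgamma : 2%:R <= gamma) :
  exists C : R, 0 < C /\
  forall (d : nat) (L : R) (F : 'rV[R]_d -> 'rV[R]_d) (A : operator R d)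
         (zstar : 'rV[R]_d) (z : nat -> 'rV[R]_d),
    0 < L -> lipschitz_map L F -> monotone_map F -> maximally_monotone A ->
    inclusion_solution F A zstar ->
    anchored_forward_backward L gamma F A z ->
    forall T : nat, (1 <= T)%N ->
      (tangent_residual F A (z T)
         <= (residual_bound L gamma (enorm (z 0%N - zstar)) T)%:E)%E /\
      residual_bound L gamma (enorm (z 0%N - zstar)) T
        <= C * (L * enorm (z 0%N - zstar) / Num.sqrt T%:R).
Proof.
have sq0 : 0 <= Num.sqrt 12%:R :> R by exact: sqrtr_ge0.
exists (25%:R * (Num.sqrt 12%:R + 1) * gamma); split.
  by rewrite !mulr_gt0 //; lra.
move=> d L F A zstar z L0 lF mF [mA _] hstar hz [//|t] _.
have D0 := enorm_ge0 (z 0%N - zstar).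
have LgD : 0 <= L * gamma * enorm (z 0%N - zstar) by rewrite !mulr_ge0 //; lra.
rewrite /residual_bound -[t.+1%:R]natr1 addrK; split.
  apply: le_trans (tangent_residual_le hgamma L0 lF mF mA hstar hz t) _.
  rewrite lee_fin ler_wpM2r ?invr_ge0 ?sqrtr_ge0 //.
  (* The proved constant 15 is below 25, hence below 25 (sqrt 12 + 1). *)
  by have := mulr_ge0 sq0 LgD; lra.
have -> : 25%:R * (Num.sqrt 12%:R + 1) * L * gamma * enorm (z 0%N - zstar)
  = 25%:R * (Num.sqrt 12%:R + 1) * gamma * (L * enorm (z 0%N - zstar)) by ring.
rewrite [leRHS]mulrA ler_wpM2l //.
  by rewrite !mulr_ge0 //; lra.
have t0 := ler0n R t.
(* With T = t + 1, this is T <= t + gamma, true because gamma >= 1. *)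
rewrite lef_pV2 ?posrE ?sqrtr_gt0 ?ler_sqrt; lra.
Qed.
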